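(* There exists $N_0$ such that for every integer $N \ge N_0$ the following holds. Let $a_0$ be a non-negative integer and let $A=\{a_1,\ldots,a_d\}$ be a set of $d$ distinct positive integers such that \[ H(a_0;a_1,\ldots,a_d) := \Big\{ a_0+\sum_{i=1}^d \epsilon_i a_i : \epsilon_i\in\{0,1\}\Big\} \subseteq S_2\cap[1,N], \] where $S_2=\{n^2 : n\in\mathbb Z\}$ is the set of integer squares. Then $d \le 7\log\log N$.
   Context: $H(a_0;a_1,\ldots,a_d)=a_0+\{0,a_1\}+\cdots+\{0,a_d\}$ is called a Hilbert cube of dimension $d$. $\log$ denotes the natural logarithm. *)

(* Defs.v *)
From mathcomp Require Export all_boot all_order all_algebra.
From mathcomp Require Export all_classical all_reals all_analysis.

Set Implicit Arguments.
Unset Strict Implicit.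
Unset Printing Implicit Defensive.

Import Order.TTheory GRing.Theory Num.Theory.
Local Open Scope classical_set_scope.
Local Open Scope ring_scope.

Definition hilbert_cube (d : nat) (a0 : int) (a : 'I_d -> int) : set int :=
  [set h | exists eps : 'I_d -> bool, h = a0 + \sum_(i < d) (eps i)%:R * a i].

Definition int_squares : set int := range (fun n : int => n ^+ 2).

(* Main.v *)
(* Writing a Hilbert cube of dimension [2 k] as a sumset [A + B] of two cubes of
   dimension [k], Fermat's theorem that no four distinct squares are in
   arithmetic progression shows that each new generator multiplies the size of a
   cube by at least [4/3], so [A] and [B] have at least [(4/3)^k] elements.  On
   the other hand, modulo an odd prime [p] one of [A], [B] occupies at most
   [sqrt p + 1] residue classes, so Gallagher's larger sieve bounds the smaller of
   them by [(ln N)^(1 + o(1))].  The constant comes from [2 / ln (4/3) < 7].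

   Fermat's theorem is reduced to the system [r^2 + q^2 = s^2],
   [r^2 + 4 q^2 = p^2]: if [a^2, b^2, c^2, d^2] is a progression of difference
   [D], then [r = b c - a d], [q = D], [s = b d - a c], [p = c d - a b] is a
   solution (translation by a torsion point on the underlying elliptic curve). *)

Require Import Defs.
From mathcomp Require Import all_boot all_order all_algebra.
From mathcomp Require Import all_classical all_reals all_analysis.
From mathcomp Require Import zify ring lra.

Set Implicit Arguments.
Unset Strict Implicit.
Unset Printing Implicit Defensive.

Import Order.TTheory GRing.Theory Num.Theory.
Local Open Scope classical_set_scope.
Local Open Scope ring_scope.

(** * Four squares in arithmetic progression *)

(** The root is [g = gcdn a c]. Dividing out [g] leaves [a' * b = g * c'^2] with [a'] coprime to
    [c'] and [b] coprime to [g], so [a'] and [g] divide each other. *)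
Lemma coprime_mul_sqr (a b c : nat) :
  coprime a b -> (a * b = c ^ 2)%N -> exists m, (a = m ^ 2)%N.
Proof.
case: (posnP a) => [-> _ _|a_gt0 cop_ab abc]; first by exists 0%N.
exists (gcdn a c); set g := gcdn a c.
have g_gt0 : (0 < g)%N by rewrite gcdn_gt0 a_gt0.
have [a' a_eq] : exists a', (a = a' * g)%N by apply/dvdnP/dvdn_gcdl.
have [c' c_eq] : exists c', (c = c' * g)%N by apply/dvdnP/dvdn_gcdr.
have cop_ac : coprime a' c'.
  rewrite /coprime -(eqn_pmul2r g_gt0) mul1n; apply/eqP.
  by rewrite muln_gcdl -a_eq -c_eq.
have abc' : (a' * b = g * c' ^ 2)%N.
  by apply/eqP; rewrite -(eqn_pmul2r g_gt0); apply/eqP; move: abc; rewrite a_eq c_eq; nia.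
have a'g : (a' %| g)%N.
  by rewrite -(@Gauss_dvdl _ _ (c' ^ 2)) ?coprimeXr // -abc' dvdn_mulr.
have ga' : (g %| a')%N.
  rewrite -(@Gauss_dvdl _ _ b) ?abc' ?dvdn_mulr //.
  by apply: coprime_dvdl cop_ab; apply: dvdn_gcdl.
have -> : (a = a' * g)%N by [].
by have /eqP -> : a' == g by rewrite eqn_dvd a'g.
Qed.

Lemma pythagorean_triple (x y z : int) :
  coprimez x y -> (x = 1 %[mod 4])%Z -> x ^+ 2 + y ^+ 2 = z ^+ 2 ->
  exists m n : int, x = m ^+ 2 - n ^+ 2 /\ y = 2 * m * n.
Proof.
wlog z_ge0 : z / 0 <= z => [wz|] cop_xy x1 xyz.
  have [z_ge0|z_lt0] := leP 0 z; first exact: wz xyz.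
  by apply: (wz (- z)); rewrite ?oppr_ge0 ?ltW // sqrrN.
have [x' x_eq] : exists x', x = 4 * x' + 1 by exists (x %/ 4)%Z; lia.
have [w y_eq] : exists w, y = 2 * w.
  (* Two odd legs would give [z^2 = 2] modulo 4. *)
  suff y_odd : (y %% 2)%Z <> 1 by exists (y %/ 2)%Z; lia.
  move=> y_odd; have [y' y_eq] : exists y', y = 2 * y' + 1 by exists (y %/ 2)%Z; lia.
  have : exists t u, z = 2 * t + u /\ (u = 0 \/ u = 1).
    by exists (z %/ 2)%Z, (z %% 2)%Z; lia.
  by case=> t [u [z_eq [] u_eq]]; move: xyz; rewrite x_eq y_eq z_eq u_eq; lia.
have [t z_eq] : exists t, z = 2 * t + 1.
  suff : (z %% 2)%Z <> 0 by exists (z %/ 2)%Z; lia.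
  move=> z_even; have [t z_eq] : exists t, z = 2 * t by exists (z %/ 2)%Z; lia.
  by move: xyz; rewrite x_eq y_eq z_eq; lia.
(* These are [(z + x) / 2] and [(z - x) / 2]: non-negative, coprime, with product [(y / 2)^2], hence
   both squares. *)
set u := t + 2 * x' + 1; set v := t - 2 * x'.
have uvw : u * v = w ^+ 2.
  by move: xyz; rewrite x_eq y_eq z_eq /u /v; lia.
have u_ge0 : 0 <= u by move: uvw; rewrite /u /v; nia.
have v_ge0 : 0 <= v by move: uvw; rewrite /u /v; nia.
have x_uv : x = u - v by rewrite x_eq /u /v; ring.
have cop_uv : coprime `|u| `|v|.
  have: coprimez x (w ^+ 2).
    by rewrite coprimezXr //; move: cop_xy; rewrite y_eq coprimezMr => /andP[].
  rewrite /coprimez /coprime -dvdn1 => /eqP cop_xw.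
  have gu : (gcdz u v %| u)%Z by apply: dvdz_gcdl.
  have gv : (gcdz u v %| v)%Z by apply: dvdz_gcdr.
  have : (gcdz u v %| gcdz x (w ^+ 2))%Z.
    by rewrite dvdz_gcd x_uv rpredB // -uvw dvdz_mulr.
  by rewrite cop_xw.
have uvw' : (`|u| * `|v| = `|w| ^ 2)%N by rewrite -abszM uvw abszX.
have [m m_eq] := coprime_mul_sqr cop_uv uvw'.
have [n n_eq] : exists n, (`|v| = n ^ 2)%N.
  by apply: (@coprime_mul_sqr _ `|u| `|w|); rewrite 1?coprime_sym // mulnC.
have um : u = m%:Z ^+ 2 by rewrite -(gez0_abs u_ge0) m_eq -mulnn PoszM expr2.
have vn : v = n%:Z ^+ 2 by rewrite -(gez0_abs v_ge0) n_eq -mulnn PoszM expr2.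
have : w ^+ 2 = (m%:Z * n%:Z) ^+ 2 by rewrite -uvw um vn; ring.
move/eqP; rewrite eqf_sqr => /orP[]/eqP w_eq.
  by exists m, n; rewrite x_uv um vn y_eq w_eq; split => //; ring.
by exists m, (- n%:Z); rewrite x_uv um vn y_eq w_eq; split; ring.
Qed.

Lemma int_parity (x : int) : (exists y, x = 2 * y) \/ (x %% 2)%Z = 1.
Proof.
have [?|?] : (x %% 2)%Z = 0 \/ (x %% 2)%Z = 1 by lia.
  by left; exists (x %/ 2)%Z; lia.
by right.
Qed.

Lemma int_mod4 (x : int) :
  [\/ (x = 1 %[mod 4])%Z, (- x = 1 %[mod 4])%Z | exists y, x = 2 * y].
Proof.
have [?|[?|?]] : (x %% 4)%Z = 1 \/ (x %% 4)%Z = 3 \/ (x %% 2)%Z = 0 by lia.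
- by constructor 1; lia.
- by constructor 2; lia.
- by constructor 3; exists (x %/ 2)%Z; lia.
Qed.

Lemma mulz_odd (x y : int) :
  (x * y %% 2)%Z = 1 -> (x %% 2)%Z = 1 /\ (y %% 2)%Z = 1.
Proof.
have [[x' ->]|x1] := int_parity x; first by rewrite -mulrA modzMr.
have [[y' ->]|y1] := int_parity y; last by [].
by rewrite mulrCA (modzMr (x * y')).
Qed.

Lemma sqr_mod8 (x : int) : (x %% 2)%Z = 1 -> exists t, x ^+ 2 = 8 * t + 1.
Proof.
move=> x_odd; have [y ->] : exists y, x = 2 * y + 1 by exists (x %/ 2)%Z; lia.
have [z [] ->] : exists z, y = 2 * z \/ y = 2 * z + 1 by exists (y %/ 2)%Z; lia.
  by exists (2 * z ^+ 2 + z); ring.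
by exists (2 * z ^+ 2 + 3 * z + 1); ring.
Qed.

Lemma sqrB_mod4 (m n : int) : (m ^+ 2 - n ^+ 2 = 1 %[mod 4])%Z ->
  (m %% 2)%Z = 1 /\ exists n', n = 2 * n'.
Proof.
have [m' [u [-> u01]]] : exists m' u, m = 2 * m' + u /\ (u = 0 \/ u = 1).
  by exists (m %/ 2)%Z, (m %% 2)%Z; lia.
have [n' [v [-> v01]]] : exists n' v, n = 2 * n' + v /\ (v = 0 \/ v = 1).
  by exists (n %/ 2)%Z, (n %% 2)%Z; lia.
rewrite !expr2.
have -> : (2 * m' + u) * (2 * m' + u) - (2 * n' + v) * (2 * n' + v) =
  4 * (m' * m' + m' * u - n' * n' - n' * v) + (u * u - v * v) by ring.
case: u01 => ->; case: v01 => -> H; last 1 [idtac]; try lia.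
by split; [lia | exists n'; lia].
Qed.

(* From [r = m^2 - n^2 = k^2 - l^2] and [q = 2 m n = k l] write [l = 2 l'] and
   factor [k l' = m n] as [(e g) (f h) = (e f) (g h)]; then
   [e^2 (g^2 - f^2) = h^2 (4 f^2 - g^2)] forces [f^2 = e^2 + h^2] and
   [g^2 = e^2 + 4 h^2]. *)
Lemma descent_step (r q s p : int) :
  coprimez r q -> (r = 1 %[mod 4])%Z -> q != 0 ->
  r ^+ 2 + q ^+ 2 = s ^+ 2 -> r ^+ 2 + 4 * q ^+ 2 = p ^+ 2 ->
  exists e h f g : int, [/\ e * h != 0, (e * h * 2 %| q)%Z,
    e ^+ 2 + h ^+ 2 = f ^+ 2 & e ^+ 2 + 4 * h ^+ 2 = g ^+ 2].
Proof.
move=> cop_rq r1 q_neq0 rqs rqp.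
have [m [n [r_mn q_mn]]] := pythagorean_triple cop_rq r1 rqs.
have cop_r2q : coprimez r (2 * q).
  rewrite coprimezMr cop_rq andbT coprimez_sym /coprimez.
  have [r' ->] : exists r', r = 4 * r' + 1 by exists (r %/ 4)%Z; lia.
  have -> : 4 * r' + 1 = 2 * r' * 2 + 1 by ring.
  by rewrite gcdzMDl.
have rqp' : r ^+ 2 + (2 * q) ^+ 2 = p ^+ 2 by rewrite -rqp; ring.
have [k [l [r_kl q_kl]]] := pythagorean_triple cop_r2q r1 rqp'.
have [m_odd _] : (m %% 2)%Z = 1 /\ exists n', n = 2 * n'.
  by apply: sqrB_mod4; rewrite -r_mn.
have [k_odd [l' l_eq]] : (k %% 2)%Z = 1 /\ exists n', l = 2 * n'.
  by apply: sqrB_mod4; rewrite -r_kl.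
have kl_mn : k * l' = m * n.
  apply: (@mulfI _ (2 * 2)) => //; transitivity (2 * q); last by rewrite q_mn; ring.
  by rewrite q_kl l_eq; ring.
have cop_mn : coprimez m n.
  have : (gcdz m n %| gcdz r q)%Z.
    rewrite dvdz_gcd r_mn q_mn.
    by rewrite rpredB ?dvdz_exp ?dvdz_gcdl ?dvdz_gcdr //= dvdz_mull // dvdz_gcdr.
  by rewrite (eqP cop_rq) dvdz1 /coprimez /gcdz eqz_nat.
have m_neq0 : m != 0 by apply: contraNneq q_neq0 => m0; rewrite q_mn m0 mulr0 mul0r.
set e := gcdz m k.
have e_neq0 : e != 0 by rewrite gcdz_eq0 (negPf m_neq0).
have [f m_eq] : exists f, m = f * e by apply/dvdzP/dvdz_gcdl.
have [g k_eq] : exists g, k = g * e by apply/dvdzP/dvdz_gcdr.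
have cop_fg : coprimez f g.
  have : gcdz (f * e) (g * e) = e by rewrite -m_eq -k_eq.
  rewrite -mulz_gcdl => fge; rewrite /coprimez.
  have e_abs : `|e|%N%:Z != 0 by rewrite eqz_nat absz_eq0.
  by apply/eqP; apply: (mulIf e_abs); rewrite fge mul1r.
clearbody e.
have gl_fn : g * l' = f * n.
  by apply: (mulIf e_neq0); rewrite mulrAC -k_eq kl_mn m_eq mulrAC.
have f_neq0 : f != 0 by apply: contraNneq m_neq0 => f0; rewrite m_eq f0 mul0r.
have [h l'_eq] : exists h, l' = h * f.
  by apply/dvdzP; rewrite -(@Gauss_dvdzr _ g) // gl_fn dvdz_mulr.
have n_eq : n = g * h.
  by apply: (mulfI f_neq0); rewrite -gl_fn l'_eq; ring.
have eh_neq0 : e * h != 0.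
  rewrite mulf_neq0 //; apply: contraNneq q_neq0 => h0.
  by rewrite q_mn n_eq h0 !mulr0.
have h_neq0 : h != 0 by apply: contraNneq eh_neq0 => ->; rewrite mulr0.
have cop_eh : coprimez (e ^+ 2) (h ^+ 2).
  rewrite coprimezXl // coprimezXr //.
  by move: cop_mn; rewrite m_eq n_eq coprimezMl => /andP[_]; rewrite coprimezMr => /andP[].
have key : e ^+ 2 * (g ^+ 2 - f ^+ 2) = h ^+ 2 * (4 * f ^+ 2 - g ^+ 2).
  move: r_mn; rewrite r_kl l_eq l'_eq n_eq k_eq m_eq => key.
  by apply/eqP; rewrite -subr_eq0; apply/eqP; move/eqP: key; rewrite -subr_eq0 => /eqP <-; ring.
have [j gf_j] : exists j, g ^+ 2 - f ^+ 2 = j * h ^+ 2.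
  apply/dvdzP; rewrite -(@Gauss_dvdzr _ (e ^+ 2)) 1?coprimez_sym //.
  by rewrite key dvdz_mulr.
have fg_j : 4 * f ^+ 2 - g ^+ 2 = j * e ^+ 2.
  apply: (@mulfI _ (h ^+ 2)); first by rewrite expf_neq0.
  by rewrite -key gf_j; ring.
have [f_odd e_odd] : (f %% 2)%Z = 1 /\ (e %% 2)%Z = 1 by apply: mulz_odd; rewrite -m_eq.
have [g_odd _] : (g %% 2)%Z = 1 /\ (e %% 2)%Z = 1 by apply: mulz_odd; rewrite -k_eq.
(* Here [3 f^2 = j (h^2 + e^2)] and [3 g^2 = j (4 h^2 + e^2)], while [f] and [g] are coprime. *)
have j_dvd3 : (j %| 3)%Z.
  have jf : (j %| 3 * f ^+ 2)%Z.
    by apply/dvdzP; exists (h ^+ 2 + e ^+ 2); rewrite [RHS]mulrC mulrDr -gf_j -fg_j; ring.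
  have jg : (j %| 3 * g ^+ 2)%Z.
    apply/dvdzP; exists (4 * h ^+ 2 + e ^+ 2).
    by rewrite [RHS]mulrC mulrDr [j * (4 * _)]mulrCA -gf_j -fg_j; ring.
  have : (j %| gcdz (3 * f ^+ 2) (3 * g ^+ 2))%Z by rewrite dvdz_gcd jf jg.
  rewrite -mulz_gcdr.
  have /eqP -> : coprimez (f ^+ 2) (g ^+ 2) by rewrite coprimezXl // coprimezXr.
  by [].
(* The squares of the odd numbers [e], [f], [g] are 1 modulo 8, so [j] is 3 modulo 8; this singles
   out 3 among the divisors 1, -1, 3, -3. *)
have j3 : j = 3.
  have [tf f8] := sqr_mod8 f_odd; have [tg g8] := sqr_mod8 g_odd.
  have [te e8] := sqr_mod8 e_odd.
  have j38 : (j %% 8)%Z = 3.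
    have j_eq : j = (4 * tf - tg - j * te) * 8 + 3.
      transitivity (j * e ^+ 2 - 8 * (j * te)); first by rewrite e8; ring.
      by rewrite -fg_j f8 g8; ring.
    by rewrite j_eq modzMDl.
  have j_le : (`|j| <= 3)%N by apply: dvdn_leq.
  by clear -j38 j_le; lia.
exists e, h, f, g; split => //.
- by apply/dvdzP; exists (f * g); rewrite q_mn m_eq n_eq; ring.
- by rewrite j3 in gf_j fg_j; clear -gf_j fg_j; lia.
- by rewrite j3 in gf_j fg_j; clear -gf_j fg_j; lia.
Qed.

(** Infinite descent on [|r * q|]. A common factor of [r] and [q] is divided out. For odd [r], a
    sign change makes [r] congruent to 1 modulo 4 and [descent_step] applies. For [r = 2 r2], also
    [p = 2 p2], and [(q, r2, p2, s)] is a solution with half the product. *)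
Lemma concordant_trivial (r q s p : int) :
  r ^+ 2 + q ^+ 2 = s ^+ 2 -> r ^+ 2 + 4 * q ^+ 2 = p ^+ 2 -> r * q = 0.
Proof.
have [n le_n] := ubnP `|(r * q)%R|%N; elim: n => // n IH in r q s p le_n *.
move=> rqs rqp; apply/eqP/negPn/negP => rq_neq0.
have descend r' q' s' p' : (`|(r' * q')%R| < `|(r * q)%R|)%N -> r' * q' != 0 ->
    r' ^+ 2 + q' ^+ 2 = s' ^+ 2 -> r' ^+ 2 + 4 * q' ^+ 2 = p' ^+ 2 -> False.
  move=> lt_rq /eqP rq' rqs' rqp'; apply: rq'; apply: IH rqs' rqp'.
  exact: leq_trans lt_rq _.
move: (rq_neq0); rewrite mulf_eq0 negb_or => /andP[r_neq0 q_neq0].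
set g := gcdz r q.
have g_neq0 : g != 0 by rewrite gcdz_eq0 (negPf r_neq0).
have [r' r_eq] : exists r', r = r' * g by apply/dvdzP/dvdz_gcdl.
have [q' q_eq] : exists q', q = q' * g by apply/dvdzP/dvdz_gcdr.
have dvd_sqr (x y : int) : (x ^+ 2 %| y ^+ 2)%Z -> (x %| y)%Z.
  by rewrite !dvdzE !abszX dvdn_pexp2r.
have [s' s_eq] : exists s', s = s' * g.
  by apply/dvdzP/dvd_sqr/dvdzP; exists (r' ^+ 2 + q' ^+ 2); rewrite -rqs r_eq q_eq; ring.
have [p' p_eq] : exists p', p = p' * g.
  by apply/dvdzP/dvd_sqr/dvdzP; exists (r' ^+ 2 + 4 * q' ^+ 2); rewrite -rqp r_eq q_eq; ring.
have g2_neq0 : g ^+ 2 != 0 by rewrite expf_neq0.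
have rq'_neq0 : r' * q' != 0.
  by apply: contraNneq rq_neq0; rewrite r_eq q_eq mulrACA => ->; rewrite mul0r.
have [g1|g_neq1] := eqVneq g 1; last first.
  apply: (@descend r' q' s' p') => //.
  - have -> : r * q = r' * q' * g ^+ 2 by rewrite r_eq q_eq; ring.
    rewrite [X in (_ < X)%N]abszM ltn_Pmulr ?absz_gt0 // abszX.
    by move: g_neq0 g_neq1; rewrite /g /gcdz; case: (gcdn _ _) => [|[|c]].
  - apply: (mulIf g2_neq0) => /=; transitivity (r ^+ 2 + q ^+ 2).
      by rewrite r_eq q_eq; ring.
    by rewrite rqs s_eq; ring.
  - apply: (mulIf g2_neq0) => /=; transitivity (r ^+ 2 + 4 * q ^+ 2).
      by rewrite r_eq q_eq; ring.
    by rewrite rqp p_eq; ring.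
have cop_rq : coprimez r q by rewrite /coprimez -/g g1.
have step r0 : (r0 = 1 %[mod 4])%Z -> r0 ^+ 2 = r ^+ 2 -> `|r0|%N = `|r|%N -> False.
  move=> r01 r0r absr0.
  have cop_r0q : coprimez r0 q by rewrite /coprimez /gcdz absr0.
  have rqs0 : r0 ^+ 2 + q ^+ 2 = s ^+ 2 by rewrite r0r.
  have rqp0 : r0 ^+ 2 + 4 * q ^+ 2 = p ^+ 2 by rewrite r0r.
  have [e [h [f [k [eh_neq0 eh_q efh ekh]]]]] :=
    descent_step cop_r0q r01 q_neq0 rqs0 rqp0.
  apply: (descend e h f k) => //.
  have q_gt0 : (0 < `|q|)%N by rewrite absz_gt0.
  have := dvdn_leq q_gt0 eh_q; rewrite abszM => le_q.
  have eh_gt0 : (0 < `|(e * h)%R|)%N by rewrite absz_gt0.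
  have lt_q : (`|(e * h)%R| < `|q|)%N by clear -le_q eh_gt0; lia.
  by apply: leq_trans lt_q _; rewrite (abszM r q) leq_pmull // absz_gt0.
have [r1|r1|[r2 r2_eq]] := int_mod4 r; first exact: step r1 _ _.
  by apply: step r1 _ _; rewrite ?sqrrN ?abszN.
have [[p2 p2_eq]|p_odd] := int_parity p; last first.
  by have [t] := sqr_mod8 p_odd; rewrite -rqp r2_eq => odd_eq; clear -odd_eq; lia.
have rq_eq : r * q = 2 * (q * r2) by rewrite r2_eq; ring.
have qr2_neq0 : q * r2 != 0 by move: rq_neq0; rewrite rq_eq mulf_eq0.
apply: (@descend q r2 p2 s) => //.
- by rewrite rq_eq [X in (_ < X)%N]abszM ltn_Pmull ?absz_gt0.
- by move: rqp; rewrite r2_eq p2_eq => rqp2; clear -rqp2; lia.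
- by rewrite -rqs r2_eq; ring.
Qed.

Lemma no_four_squares_AP (a b c d D : int) :
  b ^+ 2 = a ^+ 2 + D -> c ^+ 2 = a ^+ 2 + D *+ 2 -> d ^+ 2 = a ^+ 2 + D *+ 3 -> D = 0.
Proof.
move=> b_eq c_eq d_eq.
have rq0 : (b * c - a * d) * D = 0.
  apply: (@concordant_trivial _ _ (b * d - a * c) (c * d - a * b)).
    apply/eqP; rewrite -subr_eq0; apply/eqP.
    transitivity (b ^+ 2 * c ^+ 2 + a ^+ 2 * d ^+ 2 + D ^+ 2
                  - b ^+ 2 * d ^+ 2 - a ^+ 2 * c ^+ 2); first by ring.
    by rewrite b_eq c_eq d_eq; ring.
  apply/eqP; rewrite -subr_eq0; apply/eqP.
  transitivity (b ^+ 2 * c ^+ 2 + a ^+ 2 * d ^+ 2 + 4 * D ^+ 2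
                - c ^+ 2 * d ^+ 2 - a ^+ 2 * b ^+ 2); first by ring.
  by rewrite b_eq c_eq d_eq; ring.
(* Indeed [b^2 c^2 - a^2 d^2 = 2 D^2], and its factor [b c - a d] is killed by [D]. *)
have : 2 * D ^+ 2 * D = 0.
  transitivity ((b ^+ 2 * c ^+ 2 - a ^+ 2 * d ^+ 2) * D).
    by rewrite b_eq c_eq d_eq; ring.
  transitivity ((b * c + a * d) * ((b * c - a * d) * D)); first by ring.
  by rewrite rq0 mulr0.
by move/eqP; rewrite -mulrA -exprSr mulf_eq0 expf_eq0 => /= /eqP.
Qed.

(** * Growth of Hilbert cubes *)

(** For [x] in [H], the first of [x + a], [x + 2a], [x + 3a] to leave [H] lies in [D], the part of
    [H + a] outside [H]. Hence three translates of [D] cover [H], and [D] has at least a third of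
    the size of [H]. *)
Lemma size_undup_translate (H : seq int) (a : int) : uniq H ->
  (forall x, x \in H -> ~~ [&& x + a \in H, x + a *+ 2 \in H & x + a *+ 3 \in H]) ->
  (4 * size H <= 3 * size (undup (H ++ [seq (x + a)%R | x <- H])))%N.
Proof.
move=> uH noAP; set K := undup _.
pose D := [seq y <- [seq x + a | x <- H] | y \notin H].
have uD : uniq D by rewrite filter_uniq // map_inj_uniq //; apply: addIr.
have leHDK : (size H + size D <= size K)%N.
  rewrite -size_cat; apply: uniq_leq_size.
    rewrite cat_uniq uH uD andbT /=; apply/hasPn => y.
    by rewrite mem_filter => /andP[].
  move=> y; rewrite /K mem_undup !mem_cat mem_filter.
  by case: (y \in H) => //= ->.
have leHD : (size H <= size D + size D + size D)%N.
  have subHD : {subset H <= [seq y - a | y <- D] ++ [seq y - a *+ 2 | y <- D] ++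
                            [seq y - a *+ 3 | y <- D]}.
    move=> x xH; rewrite !mem_cat.
    have inD y : y \in H -> y + a \notin H -> y + a \in D.
      by move=> yH yaH; rewrite mem_filter yaH; apply: (map_f (fun x => x + a)).
    have := noAP x xH; rewrite !negb_and.
    have [x1H _|x1H _] := boolP (x + a \in H); last first.
      apply/orP; left; apply/mapP; exists (x + a); first exact: inD.
      by rewrite addrK.
    have [x2H|x2H] := boolP (x + a *+ 2 \in H); last first.
      apply/orP; right; apply/orP; left.
      apply/mapP; exists (x + a *+ 2); last by rewrite addrK.
      by rewrite mulr2n addrA inD // -addrA -mulr2n.
    have := noAP x xH; rewrite x1H x2H /= => x3H.
    apply/orP; right; apply/orP; right.
    apply/mapP; exists (x + a *+ 3); last by rewrite addrK.
    by rewrite mulrSr addrA inD // -addrA -mulrSr.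
  have := uniq_leq_size uH subHD.
  by rewrite !size_cat !size_map addnA.
lia.
Qed.

(** A Hilbert cube as a duplicate-free list, so that [size] counts distinct elements even when
    subset sums coincide. *)
Fixpoint cube_seq (x : int) (s : seq int) : seq int :=
  if s is a :: s' then undup (cube_seq x s' ++ [seq y + a | y <- cube_seq x s'])
  else [:: x].

Lemma cube_seq_uniq x s : uniq (cube_seq x s).
Proof. by case: s => //= a s; apply: undup_uniq. Qed.

Lemma mem_cube_seq_base x s : x \in cube_seq x s.
Proof. by elim: s => [|a s IH] /=; rewrite ?mem_head // mem_undup mem_cat IH. Qed.

(** Splits a cube into a sumset; the base point [x], present in both [y] and [z], is subtracted
    once. *)
Lemma cube_seq_cat x s t y z : y \in cube_seq x s -> z \in cube_seq x t ->
  y + (z - x) \in cube_seq x (s ++ t).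
Proof.
elim: s y => [|a s IH] y /=; first by rewrite inE => /eqP ->; rewrite addrC subrK.
rewrite !mem_undup !mem_cat => /orP[ys|/mapP[w ws ->]] zt; first by rewrite IH.
apply/orP; right; apply/mapP; exists (w + (z - x)); first exact: IH.
by rewrite addrAC.
Qed.

(** Links [cube_seq] to [hilbert_cube]. As indices do not repeat, the coefficient of a new index can
    be set without disturbing the others. *)
Lemma cube_seq_sum (I : eqType) (a : I -> int) (r : seq I) (x y : int) :
  uniq r -> y \in cube_seq x [seq a i | i <- r] ->
  exists e : I -> bool, y = x + \sum_(i <- r) (e i)%:R * a i.
Proof.
elim: r y => [|j r IH] y /=.
  by rewrite inE => _ /eqP ->; exists xpred0; rewrite big_nil addr0.
case/andP=> jr ur.
have extend (b : bool) (e : I -> bool) : exists e' : I -> bool,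
    b%:R * a j + \sum_(i <- r) (e i)%:R * a i = \sum_(i <- j :: r) (e' i)%:R * a i.
  exists (fun i => if i == j then b else e i); rewrite big_cons eqxx; congr (_ + _).
  apply: eq_big_seq => i ir; case: eqP => // ij.
  by rewrite ij (negPf jr) in ir.
rewrite mem_undup mem_cat => /orP[/(IH _ ur)[e ->]|/mapP[z /(IH _ ur)[e ->] ->]].
  by have [e' He] := extend false e; exists e'; rewrite -He mul0r add0r.
by have [e' He] := extend true e; exists e'; rewrite -He mul1r -addrA [_ + a j]addrC.
Qed.

(** By Fermat's theorem and positivity of the generators, [size_undup_translate] applies at each
    generator; the resulting bound [(4/3)^k] is stated without division. *)
Lemma size_cube_seq x s : all (fun a => 0 < a) s ->
  (forall y, y \in cube_seq x s -> int_squares y) ->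
  (4 ^ size s <= 3 ^ size s * size (cube_seq x s))%N.
Proof.
elim: s => [|a s IH] //= /andP[a_gt0 s_gt0] sq.
have {}IH : (4 ^ size s <= 3 ^ size s * size (cube_seq x s))%N.
  by apply: IH => // y yH; apply: sq; rewrite mem_undup mem_cat yH.
have sq' y : y \in cube_seq x s -> int_squares y.
  by move=> yH; apply: sq; rewrite mem_undup mem_cat yH.
have := @size_undup_translate (cube_seq x s) a (cube_seq_uniq _ _).
rewrite /= !expnS; set K := size (undup _); set H := size (cube_seq x s) in IH *.
suff noAP : forall y, y \in cube_seq x s ->
    ~~ [&& y + a \in cube_seq x s, y + a *+ 2 \in cube_seq x s
         & y + a *+ 3 \in cube_seq x s].
  move/(_ noAP) => le4; apply: leq_trans (leq_mul (leqnn 4) IH) _.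
  by rewrite mulnCA [(3 * _)%N]mulnC -mulnA leq_mul2l le4 orbT.
move=> y /sq'[b _ by_]; apply/negP => /and3P[/sq'[c _ cy] /sq'[d _ dy] /sq'[e _ ey]].
have a0 : a = 0 by apply: (@no_four_squares_AP b c d e); rewrite by_.
by rewrite a0 ltxx in a_gt0.
Qed.

(** * Sumsets of squares in a finite field *)

(** From [(x - y)(x + y) = c], the nonzero difference [x - y] determines [x + y], hence the pair. *)
Lemma card_diff_sqr (F : finFieldType) (c : F) : 2 != 0 :> F -> c != 0 ->
  (#|[pred u : F * F | (u.1 ^+ 2 - u.2 ^+ 2 == c)%R]| <= #|F|.-1)%N.
Proof.
move=> char_neq2 c_neq0; set S := [pred u | _].
have uv_neq0 u : u \in S -> u.1 - u.2 != 0.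
  rewrite inE subr_sqr => /eqP uc; apply: contraNneq c_neq0 => u0.
  by rewrite -uc u0 mul0r.
have inj : {in S &, injective (fun u : F * F => u.1 - u.2)}.
  move=> [x y] [z t] /[dup] /uv_neq0 /= xy0; rewrite !inE /= !subr_sqr.
  move=> /eqP xyc /eqP ztc eq_xyzt.
  have eq_add : x + y = z + t.
    by apply: (mulfI xy0); rewrite xyc eq_xyzt ztc.
  have eq_x : x = z.
    apply: (mulfI char_neq2); transitivity ((x - y) + (x + y)); first by ring.
    by rewrite eq_xyzt eq_add; ring.
  by congr pair => //; move: eq_add; rewrite eq_x => /addrI.
rewrite -(card_in_image inj) -(cardC1 (0 : F)); apply: subset_leq_card.
by apply/fintype.subsetP => _ /fintype.imageP[u uS ->]; rewrite inE /= uv_neq0.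
Qed.

(** The solutions lie on the lines [y = x] and [y = -x], which share the origin. *)
Lemma card_eq_sqr (F : finFieldType) :
  (#|[pred u : F * F | (u.1 ^+ 2 - u.2 ^+ 2 == 0)%R]| <= #|F| + #|F|.-1)%N.
Proof.
have sub : [pred u : F * F | u.1 ^+ 2 - u.2 ^+ 2 == 0] \subset
  [predU codom (fun x : F => (x, x)) & [seq (x, - x)%R | x in predC1 (0 : F)]].
  apply/fintype.subsetP => -[x y]; rewrite !inE /= subr_eq0 eqf_sqr.
  have [-> _|ne_xy /= /eqP x_eq] := eqVneq x y; first by rewrite codom_f.
  have y_eq : y = - x by rewrite x_eq opprK.
  apply/orP; right; rewrite y_eq; apply/fintype.imageP; exists x => //.
  rewrite inE /=; apply: contraNneq ne_xy => x0.
  by rewrite y_eq x0 oppr0.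
apply: leq_trans (subset_leq_card sub) _.
apply: leq_trans (_ : _ <= #|codom (fun x : F => (x, x))| +
  #|[seq (x, - x)%R | x in predC1 (0%R : F)]|)%N _.
  by rewrite -cardUI leq_addr.
rewrite leq_add //; first by rewrite (leq_trans (leq_image_card _ _)).
by rewrite (leq_trans (leq_image_card _ _)) // cardC1.
Qed.

(** When 2 is nonzero in [F] this is 1 plus the quadratic character of [u]; counting roots replaces
    character sums. *)
Definition nroot (F : finFieldType) (u : F) : nat := #|[pred x : F | x ^+ 2 == u]|.

Lemma sum_nroot (F : finFieldType) (a : F) : (\sum_b nroot (a + b)%R = #|F|)%N.
Proof.
rewrite (reindex_inj (addrI (- a))) /=.
under eq_bigr => b _ do rewrite addNKr.
rewrite -[RHS]sum1_card [RHS](partition_big (fun x : F => x ^+ 2) predT) //=.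
by apply: eq_bigr => b _; rewrite /nroot -sum1_card; apply: eq_bigl => x.
Qed.

(** The left side counts triples with [x^2 = a + b] and [y^2 = a' + b]; eliminating [b] leaves the
    pairs [(x, y)]. *)
Lemma sum_nroot_mul (F : finFieldType) (a a' : F) :
  (\sum_b nroot (a + b)%R * nroot (a' + b)%R =
   #|[pred u : F * F | (u.1 ^+ 2 - u.2 ^+ 2 == a - a')%R]|)%N.
Proof.
rewrite -[RHS]sum1_card [RHS](partition_big (fun u : F * F => u.1 ^+ 2 - a) predT) //=.
apply: eq_bigr => b _; rewrite -cardX -sum1_card; apply: eq_bigl => -[x y].
rewrite !inE /=; apply/andP/andP => -[/eqP H1 /eqP H2]; split; apply/eqP.
- by rewrite H1 H2; ring.
- by rewrite H1; ring.
- by rewrite -H2; ring.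
- have -> : y ^+ 2 = x ^+ 2 - (x ^+ 2 - y ^+ 2) by ring.
  by rewrite H1 -H2; ring.
Qed.

(** A nonzero square has the two roots [x] and [-x]; the extra term compensates for the single root
    of 0. *)
Lemma nroot_ge (F : finFieldType) (x a : F) : 2 != 0 :> F -> x ^+ 2 = a -> (2 <= nroot a + (a == 0)%R)%N.
Proof.
move=> char_neq2 xa; have [a0|a_neq0] := eqVneq a 0.
  by rewrite addn1 ltnS; apply/card_gt0P; exists x; rewrite inE xa.
rewrite addn0; have x_neq0 : x != 0.
  by apply: contraNneq a_neq0 => x0; rewrite -xa x0 expr0n.
have xNx : x != - x.
  by rewrite -subr_eq0 opprK -mulr2n -mulr_natl mulf_neq0.
have <- : #|pred2 x (- x)| = 2%N by rewrite card2 xNx.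
apply: subset_leq_card; apply/fintype.subsetP => y; rewrite !inE.
by case/orP => /eqP ->; rewrite ?sqrrN xa.
Qed.

(* Second moment of the deviation of [#{(a, x) | a + b = x ^+ 2}] from its mean
   [#|A|], as [b] ranges over [F]; on [B] the deviation is at least [#|A| - 1]. *)
Lemma sumset_sqr_bound (F : finFieldType) (A B : {set F}) :
  2 != 0 :> F ->
  (forall a b, a \in A -> b \in B -> exists x, x ^+ 2 = a + b) ->
  (#|B| * #|A|.-1 ^ 2 <= #|F| * #|A|)%N.
Proof.
move=> char_neq2 sqAB.
pose f b := (\sum_(a in A) nroot (a + b)%R)%N.
pose q := #|F|; pose al := #|A|.
have q_gt0 : (0 < q)%N by rewrite /q (cardD1 (0 : F)).
have sum_f : (\sum_b f b = al * q)%N.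
  rewrite /f exchange_big /=; under eq_bigr => a _ do rewrite sum_nroot.
  by rewrite sum_nat_const.
have sum_f2 : (\sum_b f b ^ 2 + al ^ 2 <= al * q + al ^ 2 * q)%N.
  have -> : (\sum_b f b ^ 2 = \sum_(a in A) \sum_(a' in A)
      #|[pred u : F * F | (u.1 ^+ 2 - u.2 ^+ 2 == a - a')%R]|)%N.
    under eq_bigr => b _ do rewrite -mulnn /f big_distrlr /=.
    rewrite exchange_big /=; apply: eq_bigr => a _.
    by rewrite exchange_big /=; apply: eq_bigr => a' _; rewrite sum_nroot_mul.
  (* The diagonal term is at most [2q - 1] and each of the [al - 1] others at most [q - 1]; with the
     added [al] the total is exactly [q + al * q]. *)
  have row a : a \in A -> (\sum_(a' in A)
      #|[pred u : F * F | (u.1 ^+ 2 - u.2 ^+ 2 == a - a')%R]| + al <= q + al * q)%N.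
    move=> aA; rewrite (bigD1 a) //= subrr.
    have le_sum : (\sum_(i in A | i != a)
      #|[pred u : F * F | (u.1 ^+ 2 - u.2 ^+ 2 == a - i)%R]| <= al.-1 * q.-1)%N.
      have -> : (al.-1 * q.-1 = \sum_(i in A | i != a) q.-1)%N.
        rewrite sum_nat_const; congr muln; rewrite /al (cardD1 a) aA /=.
        by apply: eq_card => i; rewrite !inE andbC.
      by apply: leq_sum => i /andP[_ ia]; apply: card_diff_sqr => //; rewrite subr_eq0 eq_sym.
    have := card_eq_sqr F; rewrite -/q => le0.
    have al_gt0 : (0 < al)%N by rewrite /al (cardD1 a) aA.
    apply: leq_trans (leq_add (leq_add le0 le_sum) (leqnn al)) _.
    by case: (al) al_gt0 (q) q_gt0 => // al' _ [//|q'] _ /=; nia.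
  have -> : (al ^ 2 = \sum_(a in A) al)%N by rewrite sum_nat_const -mulnn.
  rewrite -big_split /=.
  apply: leq_trans (_ : _ <= \sum_(a in A) (q + al * q))%N _; first exact: leq_sum.
  by rewrite !sum_nat_const -/al; nia.
have [al0|al_gt0] := posnP al; first by rewrite -/al al0 !muln0.
have f_ge b : b \in B -> ((f b)%:Z - al%:Z) ^+ 2 >= ((al.-1)%:Z) ^+ 2.
  move=> bB.
  (* Only [a = -b] can contribute a single root, whence the loss of 1. *)
  have : (al * 2 <= f b + 1)%N.
    apply: leq_trans (_ : _ <= \sum_(a in A) (nroot (a + b)%R + (a + b == 0)%R))%N _.
      rewrite -sum_nat_const; apply: leq_sum => a aA.
      by have [x xab] := sqAB a b aA bB; apply: nroot_ge char_neq2 xab.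
    rewrite big_split /= leq_add2l.
    have [bA|bA] := boolP (- b \in A).
      rewrite (bigD1 (- b)) //= addNr eqxx big1 // => i /andP[_ ib].
      by rewrite addr_eq0 (negPf ib).
    rewrite big1 // => i iA; rewrite addr_eq0.
    by case: eqP => // ib; rewrite -ib iA in bA.
  by move=> le_f; rewrite lerXn2r ?nnegrE //; lia.
have var : \sum_b ((f b)%:Z - al%:Z) ^+ 2 <= (al * q)%:Z - al%:Z ^+ 2.
  have -> : \sum_b ((f b)%:Z - al%:Z) ^+ 2 =
    (\sum_b f b ^ 2)%N%:Z - 2 * al%:Z * (\sum_b f b)%N%:Z + q%:Z * al%:Z ^+ 2.
    rewrite !(big_morph Posz PoszD (erefl _)) mulr_sumr -sumrB.
    rewrite /q -[X in X%:Z * _]sum1_card (big_morph Posz PoszD (erefl _)) mulr_suml.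
    rewrite -big_split /=; apply: eq_bigr => b _.
    by rewrite -mulnn PoszM; ring.
  by move: sum_f2; rewrite sum_f; nia.
have le_B : (#|B| * al.-1 ^ 2)%:Z <= \sum_b ((f b)%:Z - al%:Z) ^+ 2.
  rewrite (bigID (mem B)) /=.
  have -> : (#|B| * al.-1 ^ 2)%:Z = \sum_(b in B) al.-1%:Z ^+ 2.
    by rewrite sumr_const -mulr_natl; lia.
  by rewrite (le_trans (ler_sum _ f_ge)) // lerDl sumr_ge0 // => i _; rewrite sqr_ge0.
by move: (le_trans le_B var); rewrite -/al -/q; nia.
Qed.

(** In [sumset_sqr_bound], with the smaller set as the one whose size is squared, the larger size is
    bounded below by the smaller one, which then cancels. *)
Lemma sumset_sqr_min (F : finFieldType) (A B : {set F}) :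
  2 != 0 :> F ->
  (forall a b, a \in A -> b \in B -> exists x, x ^+ 2 = a + b) ->
  (#|A|.-1 ^ 2 <= #|F|)%N \/ (#|B|.-1 ^ 2 <= #|F|)%N.
Proof.
move=> char_neq2 sqAB; have [leAB|/ltnW leBA] := leqP #|A| #|B|; [left|right].
  have := sumset_sqr_bound char_neq2 sqAB.
  have [->|A_gt0] := posnP #|A|; first by [].
  by nia.
have sqBA b a : b \in B -> a \in A -> exists x, x ^+ 2 = b + a.
  by move=> bB aA; rewrite addrC; apply: sqAB.
have := sumset_sqr_bound char_neq2 sqBA.
have [->|B_gt0] := posnP #|B|; first by [].
by nia.
Qed.

(** * A lower bound for the number of primes *)

(** By Legendre's formula the exponent of [p] is the sum over [k] of
    [floor(2n / p^k) - 2 floor(n / p^k)]; each term is at most 1, and it vanishes once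
    [p^k > 2n]. *)
Lemma expn_logn_bin_le (p n : nat) : prime p -> (0 < n)%N ->
  (p ^ logn p 'C(n.*2, n) <= n.*2)%N.
Proof.
move=> p_pr n_gt0; set N := n.*2.
have N_gt0 : (0 < N)%N by rewrite double_gt0.
have p_gt1 := prime_gt1 p_pr.
suff le_log : (logn p 'C(N, n) <= trunc_log p N)%N.
  by apply: leq_trans (trunc_logP p_gt1 N_gt0); rewrite leq_exp2l.
have : (logn p 'C(N, n) + (logn p n`! + logn p n`!) = logn p N`!)%N.
  rewrite -!lognM ?fact_gt0 ?muln_gt0 ?fact_gt0 ?bin_gt0 // ?/N -?addnn ?leq_addr //.
  by rewrite -(@bin_fact (n + n) n) ?leq_addr // addnK.
rewrite !logn_fact //.
have -> : (\sum_(1 <= k < n.+1) n %/ p ^ k = \sum_(1 <= k < N.+1) n %/ p ^ k)%N.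
  rewrite [RHS](@big_cat_nat _ _ _ n.+1) //=; last by rewrite ltnS /N -addnn leq_addr.
  rewrite [X in (_ + X)%N]big_nat [X in (_ + X)%N]big1 ?addn0 // => k /andP[ltnk _].
  by rewrite divn_small // (leq_trans ltnk) // ltnW // ltn_expl.
rewrite -big_split /= => sum_eq.
have term k : (N %/ p ^ k <= n %/ p ^ k + n %/ p ^ k + (k <= trunc_log p N))%N.
  have [le_k|lt_k] := leqP k (trunc_log p N).
    have pk_gt0 : (0 < p ^ k)%N by rewrite expn_gt0 prime_gt0.
    rewrite addn1 -ltnS ltn_divLR // /N -addnn.
    by have := ltn_ceil n pk_gt0; nia.
  rewrite divn_small // (leq_trans (trunc_log_ltn N p_gt1)) // leq_exp2l //.
have : (\sum_(1 <= k < N.+1) N %/ p ^ k <=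
  \sum_(1 <= k < N.+1) (n %/ p ^ k + n %/ p ^ k + (k <= trunc_log p N)))%N.
  by apply: leq_sum => k _; apply: term.
rewrite big_split /= -sum_eq addnC leq_add2l => /leq_trans; apply.
have le_tN : (trunc_log p N <= N)%N.
  by rewrite -(leq_exp2l _ _ p_gt1) (leq_trans (trunc_logP p_gt1 N_gt0)) // ltnW // ltn_expl.
rewrite (@big_cat_nat _ _ _ (trunc_log p N).+1) //=.
rewrite [X in (_ + X)%N]big_nat [X in (_ + X)%N]big1 ?addn0; last first.
  by move=> k /andP[ltk _]; rewrite leqNgt ltk.
apply: leq_trans (_ : _ <= \sum_(1 <= k < (trunc_log p N).+1) 1)%N _.
  by apply: leq_sum => k _; apply: leq_b1.
by rewrite sum_nat_const_nat muln1 subn1.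
Qed.

(** Each step at least doubles: [C(2n+2, n+1) = 2 C(2n+1, n) >= 2 C(2n, n)]. *)
Lemma expn_le_bin (n : nat) : (2 ^ n <= 'C(n.*2, n))%N.
Proof.
elim: n => // n IH; rewrite doubleS expnS.
have := mul_bin_diag n.*2.+1 n; rewrite binS => H.
have sym : ('C(n.*2.+1, n.+1) = 'C(n.*2.+1, n))%N.
  by rewrite -(@bin_sub n.*2.+1 n) -?addnn ?leqW ?leq_addr // -addnS addKn.
rewrite [X in (_ <= X)%N]binS sym addnn -mul2n leq_pmul2l //.
apply: leq_trans IH _; case: n {H sym} => // n.
by rewrite [X in (_ <= X)%N]binS leq_addr.
Qed.

(** Chebyshev's argument with [2n = 4^m]: the central binomial is at least [2^n], and it is a
    product of prime powers at most [2n], one for each prime dividing it. *)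
Lemma prime_count_lower (m : nat) :
  (4 ^ m <= 4 * m * size [seq p <- iota 1 (4 ^ m) | prime p])%N \/ m = 0%N.
Proof.
case: m => [|m']; [by right | left; set m := m'.+1].
set n := (2 ^ (m.*2).-1)%N; set P := [seq p <- _ | _].
have n_gt0 : (0 < n)%N by rewrite expn_gt0.
have n2 : (n.*2 = 4 ^ m)%N.
  by rewrite /n -mul2n -expnS /m doubleS /= -doubleS -mul2n expnM.
have bin_pos : (0 < 'C(n.*2, n))%N by rewrite bin_gt0 -addnn leq_addr.
have le_bin : ('C(n.*2, n) <= n.*2 ^ size P)%N.
  rewrite {1}[('C(_, _))%N](prod_prime_decomp bin_pos) prime_decompE big_map /=.
  apply: leq_trans (_ : _ <= \prod_(p <- primes 'C(n.*2, n)) n.*2)%N _.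
    rewrite big_seq [X in (_ <= X)%N]big_seq.
    by apply: leq_prod => p; rewrite mem_primes => /andP[p_pr _]; apply: expn_logn_bin_le.
  rewrite big_const_seq count_predT iter_muln_1 leq_exp2l; last by rewrite -addnn; lia.
  apply: uniq_leq_size (primes_uniq _) _ => p p_in.
  have := p_in; rewrite mem_primes mem_filter mem_iota => /and3P[p_pr _ _].
  rewrite p_pr prime_gt0 // add1n ltnS -n2.
  apply: leq_trans (expn_logn_bin_le p_pr n_gt0).
  by rewrite -{1}[p]expn1 leq_exp2l ?prime_gt1 // logn_gt0.
have : (2 ^ n <= 2 ^ (m.*2 * size P))%N.
  apply: leq_trans (expn_le_bin n) _; apply: leq_trans le_bin _.
  by rewrite n2 expnM -mul2n (expnM 2 2).
by rewrite leq_exp2l // -n2; lia.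
Qed.

(** * The larger sieve *)

Lemma sqr_sum_le (I : finType) (A : {pred I}) (c : I -> nat) :
  ((\sum_(i in A) c i) ^ 2 <= #|A| * \sum_(i in A) c i ^ 2)%N.
Proof.
rewrite -(leq_pmul2l (isT : (0 < 2)%N)) -mulnn big_distrlr /= big_distrr /=.
apply: leq_trans (_ : _ <= \sum_(i in A) \sum_(j in A) (c i ^ 2 + c j ^ 2))%N _.
  apply: leq_sum => i _; rewrite big_distrr /=; apply: leq_sum => j _.
  exact: nat_Cauchy.
under eq_bigr => i _ do rewrite big_split /= sum_nat_const.
by rewrite big_split /= sum_nat_const -big_distrr /= addnn mul2n.
Qed.

(** Cauchy-Schwarz on the fibre sizes of [f] over [S]: they sum to [size A], and their squares sum
    to the number of colliding pairs. *)
Lemma collision_lower (T : Type) (F : finType) (f : T -> F) (A : seq T) (S : {set F}) :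
  all (fun a => f a \in S) A ->
  (size A ^ 2 <= #|S| * \sum_(a <- A) \sum_(b <- A) (f b == f a))%N.
Proof.
move=> AS; pose c y := (\sum_(b <- A) (f b == y))%N.
have pick1 (g : F -> nat) y : y \in S -> (\sum_(z in S) (y == z) * g z = g y)%N.
  move=> yS; rewrite (bigD1 y) //= eqxx mul1n big1 ?addn0 // => z /andP[_ zy].
  by rewrite eq_sym (negPf zy).
have sumA (g : T -> nat) (g' : T -> nat) : (forall a, f a \in S -> g a = g' a) ->
    (\sum_(a <- A) g a = \sum_(a <- A) g' a)%N.
  move=> gg'; elim: A AS {c} => [|a A' IH] /=; first by rewrite !big_nil.
  by case/andP=> aS /IH; rewrite !big_cons gg' // => ->.
have -> : size A = (\sum_(y in S) c y)%N.
  rewrite /c exchange_big /= -sum1_size.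
  apply: (sumA (fun=> 1%N) (fun a => \sum_(i in S) (f a == i))%N) => a aS.
  by rewrite -[LHS](pick1 (fun=> 1%N) _ aS); apply: eq_bigr => z _; rewrite muln1.
have -> : (\sum_(a <- A) \sum_(b <- A) (f b == f a) = \sum_(y in S) c y ^ 2)%N.
  under [RHS]eq_bigr => y _ do rewrite -mulnn {1}/c big_distrl /=.
  rewrite [RHS]exchange_big /=.
  by apply: (sumA _ (fun a => \sum_(y in S) (f a == y) * c y)%N) => a aS; rewrite (pick1 c).
exact: sqr_sum_le.
Qed.

Lemma expn_size_primes (n : nat) : (0 < n)%N -> (2 ^ size (primes n) <= n)%N.
Proof.
move=> n_gt0; rewrite {2}(prod_prime_decomp n_gt0) prime_decompE big_map /=.
apply: leq_trans (_ : _ <= \prod_(p <- primes n) 2)%N _.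
  by rewrite big_const_seq count_predT iter_muln_1.
rewrite big_seq [X in (_ <= X)%N]big_seq; apply: leq_prod => p p_in.
have := p_in; rewrite mem_primes => /andP[p_pr _].
apply: leq_trans (prime_gt1 p_pr) _.
by rewrite -{1}[p]expn1 leq_exp2l ?prime_gt1 // logn_gt0.
Qed.

Definition residues (p : nat) (A : seq int) : {set 'F_p} :=
  finset (mem [seq (a%:~R : 'F_p) | a <- A]).

Lemma eq_intr_Fp (p : nat) (a b : int) : prime p ->
  (a%:~R == b%:~R :> 'F_p) = (p %| `|a - b|)%N.
Proof.
by move=> p_pr; rewrite -subr_eq0 -intrB -(dvdz_pcharf (pchar_Fp p_pr)) dvdzE.
Qed.

Lemma sum_nat_of_bool (T : Type) (P : pred T) (s : seq T) :
  (\sum_(x <- s) P x = count P s)%N.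
Proof. by elim: s => [|x s IH]; rewrite ?big_nil // big_cons IH. Qed.

(* Gallagher's larger sieve, counted with the crude weight 1 instead of [log p]. *)
Lemma larger_sieve (A : seq int) (P : seq nat) (M L : nat) :
  uniq A -> uniq P -> all prime P ->
  (forall a b, a \in A -> b \in A -> (`|a - b| < 2 ^ L)%N) ->
  (forall p, p \in P -> (#|residues p A| <= M)%N) ->
  (size P * size A ^ 2 <= M * (size A * size P + size A ^ 2 * L))%N.
Proof.
move=> uA uP prP diffA resA.
apply: leq_trans (_ : _ <= \sum_(p <- P) M * \sum_(a <- A) \sum_(b <- A)
                             (p %| `|b - a|))%N _.
  rewrite -sum1_size big_distrl /= big_seq [X in (_ <= X)%N]big_seq.
  apply: leq_sum => p pP; rewrite mul1n.
  have p_pr := allP prP p pP.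
  apply: leq_trans (@collision_lower _ _ (fun a : int => a%:~R : 'F_p) A (residues p A) _) _.
    by apply/allP => a aA; rewrite inE; apply/mapP; exists a.
  rewrite leq_mul ?resA //; apply: leq_sum => a _; apply: leq_sum => b _.
  by rewrite eq_intr_Fp.
rewrite -big_distrr /= leq_mul2l; apply/orP; right.
rewrite exchange_big /=.
apply: leq_trans (_ : _ <= \sum_(a <- A) (size P + size A * L))%N _; last first.
  by rewrite big_const_seq count_predT iter_addn_0; lia.
rewrite big_seq [X in (_ <= X)%N]big_seq; apply: leq_sum => a aA.
rewrite exchange_big /=.
(* Every prime divides the zero difference of a diagonal pair; a nonzero difference below [2^L] has
   fewer than [L] prime divisors. *)
apply: leq_trans (_ : _ <= \sum_(b <- A) ((b == a) * size P + L))%N _; last first.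
  rewrite big_split /= -big_distrl /= big_const_seq count_predT iter_addn_0 [(L * _)%N]mulnC leq_add2r.
  have -> : (\sum_(b <- A) (b == a) = count_mem a A)%N.
    exact: sum_nat_of_bool.
  by rewrite count_uniq_mem // aA mul1n.
rewrite big_seq [X in (_ <= X)%N]big_seq; apply: leq_sum => b bA.
have -> : (\sum_(p <- P) (p %| `|b - a|) = count (fun p => p %| `|b - a|) P)%N.
  exact: sum_nat_of_bool.
have [_|ne_ba] := eqVneq b a; first by rewrite mul1n (leq_trans (count_size _ _)) ?leq_addr.
have n_gt0 : (0 < `|b - a|)%N by rewrite absz_gt0 subr_eq0.
rewrite mul0n add0n ltnW // -(ltn_exp2l _ _ (isT : (1 < 2)%N)).
apply: leq_ltn_trans (diffA b a bA aA).
apply: leq_trans (expn_size_primes n_gt0); rewrite leq_exp2l // -size_filter.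
apply: uniq_leq_size; first by rewrite filter_uniq.
move=> p; rewrite mem_filter mem_primes n_gt0 => /andP[-> /(allP prP) ->].
by [].
Qed.

(** For each odd prime [p <= 4^m], one of [A], [B] meets at most [sqrt p + 1 <= M] classes. The
    larger sieve allows at most [2ML] such primes for each set, which is compared with Chebyshev's
    lower bound. *)
Lemma sumset_sqr_sieve (A B : seq int) (m L : nat) :
  (0 < m)%N -> (0 < L)%N -> uniq A -> uniq B ->
  (forall a b, a \in A -> b \in A -> (`|a - b| < 2 ^ L)%N) ->
  (forall a b, a \in B -> b \in B -> (`|a - b| < 2 ^ L)%N) ->
  (forall a b, a \in A -> b \in B -> int_squares (a + b)) ->
  (2 * (2 ^ m + 1) <= size A)%N -> (2 * (2 ^ m + 1) <= size B)%N ->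
  (2 ^ m <= 28 * m * L)%N.
Proof.
move=> m_gt0 L_gt0 uA uB diffA diffB sqAB; set M := (2 ^ m + 1)%N => sizeA sizeB.
pose good (C : seq int) p := [&& prime p, p != 2%N & #|residues p C| <= M]%N.
pose P C := [seq p <- iota 1 (4 ^ m) | good C p].
have M_gt0 : (0 < M)%N by rewrite /M addn1.
(* As [M] is at most half of [size C], the diagonal term of the sieve is absorbed into the left
   side. *)
have boundP C : uniq C -> (2 * M <= size C)%N ->
    (forall a b, a \in C -> b \in C -> (`|a - b| < 2 ^ L)%N) ->
    (size (P C) <= 2 * M * L)%N.
  move=> uC sizeC diffC.
  have := @larger_sieve C (P C) M L uC _ _ diffC _.
  have H1 : uniq (P C) by rewrite filter_uniq // iota_uniq.
  have H2 : all prime (P C).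
    by apply/allP => p; rewrite mem_filter => /andP[/and3P[]].
  have H3 p : p \in P C -> (#|residues p C| <= M)%N.
    by rewrite mem_filter => /andP[/and3P[]].
  move/(_ H1 H2 H3); set z := size C in sizeC *; set w := size (P C).
  have z_gt0 : (0 < z)%N by lia.
  have -> : (w * z ^ 2 = w * z * z)%N by rewrite -mulnn mulnA.
  have -> : (M * (z * w + z ^ 2 * L) = (M * w + M * L * z) * z)%N by rewrite -mulnn; ring.
  rewrite leq_pmul2r // => le1.
  have le2 : (2 * M * w <= z * w)%N by rewrite leq_mul2r sizeC orbT.
  have : (w * z <= 2 * M * L * z)%N by lia.
  by rewrite leq_pmul2r.
have := boundP A uA sizeA diffA; have := boundP B uB sizeB diffB => leB leA.
have resAB p : prime p -> p != 2%N -> (p <= 4 ^ m)%N -> good A p || good B p.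
  move=> p_pr p_neq2 p_le; rewrite /good p_pr p_neq2 /=.
  have two_neq0 : 2 != 0 :> 'F_p.
    rewrite -(dvdn_pcharf (pchar_Fp p_pr)); apply/negP => /dvdn_leq => /(_ isT).
    by have := prime_gt1 p_pr; lia.
  have sqres a b : a \in residues p A -> b \in residues p B ->
      exists x : 'F_p, x ^+ 2 = a + b.
    rewrite !inE => /mapP[a' a'A ->] /mapP[b' b'B ->].
    have [x _ xab] := sqAB a' b' a'A b'B.
    by exists x%:~R; rewrite -rmorphXn /= xab intrD.
  have le_M (k : nat) : (k.-1 ^ 2 <= #|'F_p|)%N -> (k <= M)%N.
    rewrite card_Fp // => le_k.
    have : (k.-1 ^ 2 <= (2 ^ m) ^ 2)%N.
      by rewrite (leq_trans le_k) // -expnM mulnC expnM.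
    by rewrite leq_sqr /M; lia.
  by apply/orP; have [/le_M|/le_M] := sumset_sqr_min two_neq0 sqres; [left|right].
have [|m0] := prime_count_lower m; last by rewrite m0 in m_gt0.
set w := size _ => count_w.
(* The summand 1 accounts for the prime 2. *)
have le_w : (w <= 1 + (size (P A) + size (P B)))%N.
  rewrite /w !size_filter.
  apply: leq_trans (_ : _ <= count (predU (pred1 2%N) (predU (good A) (good B)))
                          (iota 1 (4 ^ m)))%N _.
    rewrite -!size_filter; apply: uniq_leq_size; first by rewrite filter_uniq ?iota_uniq.
    move=> p; rewrite !mem_filter => /andP[p_pr p_in]; rewrite p_in andbT.
    have [//|p_neq2] := eqVneq p 2%N; first by move=> ->.
    by rewrite /= (negPf p_neq2) /= resAB //; move: p_in; rewrite mem_iota add1n ltnS => /andP[].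
  have countU (a b : pred nat) s : (count (predU a b) s <= count a s + count b s)%N.
    by rewrite -count_predUI leq_addr.
  apply: leq_trans (countU _ _ _) _; apply: leq_add => //.
  by rewrite count_uniq_mem ?iota_uniq // leq_b1.
have two_m : (2 <= 2 ^ m)%N by rewrite -{1}[2%N]expn1 leq_exp2l.
have : (2 ^ m * 2 ^ m <= 4 * m * (1 + 4 * M * L))%N.
  rewrite -expnMn; apply: leq_trans count_w _; rewrite leq_mul2l; apply/orP; right.
  by apply: leq_trans le_w _; lia.
move=> le_final; rewrite -(@leq_pmul2r (2 ^ m)) ?expn_gt0 //.
apply: leq_trans le_final _.
(* The excess [1 + 4L] is at most [5L], hence at most [3 * 2^m * L]; the constant 28 is [4 * 7]. *)
have : (1 + 4 * M * L <= 7 * 2 ^ m * L)%N by rewrite /M; nia.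
move=> le7; apply: leq_trans (leq_mul (leqnn _) le7) _.
by rewrite leq_eqVlt; apply/orP; left; apply/eqP; ring.
Qed.

(** * Hilbert cubes in the squares *)

(** Two disjoint blocks of [k] generators give the two summands. Each has at least
    [(4/3)^k >= 2^(m+2)] elements, which for [m > 0] exceeds the [2 (2^m + 1)] required by the
    sieve. *)
Lemma cube_sqr_sieve (N : int) (d : nat) (a0 : int) (a : 'I_d -> int) (k m L : nat) :
  (k + k <= d)%N -> (0 < L)%N -> N < (2 ^ L)%N%:Z -> (forall i, 0 < a i) ->
  hilbert_cube a0 a `<=` int_squares `&` `[1, N] ->
  (2 ^ m.+2 * 3 ^ k <= 4 ^ k)%N -> (2 ^ m <= 28 * m.+1 * L)%N.
Proof.
move=> le_kd L_gt0 ltNL a_gt0 cubeN le_mk.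
case: m => [|m'] in le_mk *; first by lia.
set m := m'.+1 in le_mk *.
pose u := [seq a i | i <- enum 'I_d].
have size_u : size u = d by rewrite size_map size_enum_ord.
pose s := take k u; pose t := take k (drop k u); pose r := drop k (drop k u).
have u_eq : u = s ++ (t ++ r) by rewrite !cat_take_drop.
have size_s : size s = k by rewrite size_takel // size_u; lia.
have size_t : size t = k by rewrite size_takel // size_drop size_u; lia.
have u_gt0 : all (fun b => 0 < b) u by apply/allP => _ /mapP[i _ ->].
have [s_gt0 t_gt0] : all (fun b => 0 < b) s /\ all (fun b => 0 < b) t.
  by move: u_gt0; rewrite u_eq !all_cat => /and3P[].
have inN y : y \in cube_seq a0 u -> int_squares y /\ 1 <= y <= N.
  move=> /cube_seq_sum-/(_ (enum_uniq _))[e y_eq].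
  have [] : (int_squares `&` `[1, N]) y.
    by apply: cubeN; exists e; rewrite y_eq big_enum.
  by rewrite /= in_itv.
have addN y z : y \in cube_seq a0 s -> z \in cube_seq a0 t ->
    y + (z - a0) \in cube_seq a0 u.
  move=> ys zt; rewrite u_eq; apply: cube_seq_cat => //.
  by have := cube_seq_cat zt (mem_cube_seq_base a0 r); rewrite subrr addr0.
have sN y : y \in cube_seq a0 s -> int_squares y /\ 1 <= y <= N.
  move=> ys; apply: inN.
  by have := addN _ _ ys (mem_cube_seq_base a0 t); rewrite subrr addr0.
have tN y : y \in cube_seq a0 t -> int_squares y /\ 1 <= y <= N.
  move=> yt; apply: inN.
  by have := addN _ _ (mem_cube_seq_base a0 s) yt; rewrite addrC subrK.
(* Moved to base point 0, so that sums with the first block stay in the original cube. *)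
pose B := [seq y - a0 | y <- cube_seq a0 t].
have large v : size v = k -> all (fun b => 0 < b) v ->
    (forall y, y \in cube_seq a0 v -> int_squares y /\ 1 <= y <= N) ->
    (2 * (2 ^ m + 1) <= size (cube_seq a0 v))%N.
  move=> size_v v_gt0 vN.
  have := @size_cube_seq a0 v v_gt0 (fun y yv => (vN y yv).1).
  rewrite size_v => /(leq_trans le_mk); rewrite mulnC leq_pmul2l ?expn_gt0 //.
  by apply: leq_trans; rewrite !expnS; have := expn_gt0 2 m'; lia.
have close y z : 1 <= y <= N -> 1 <= z <= N -> (`|y - z| < 2 ^ L)%N.
  by move=> yN zN; clear -ltNL yN zN; lia.
apply: leq_trans (_ : 28 * m * L <= _)%N; last by rewrite leq_mul // leq_mul.
apply: (@sumset_sqr_sieve (cube_seq a0 s) B) => //.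
- exact: cube_seq_uniq.
- by rewrite map_inj_uniq ?cube_seq_uniq //; apply: addIr.
- by move=> y z /sN[_ ?] /sN[_ ?]; apply: close.
- move=> _ _ /mapP[y /tN[_ yN] ->] /mapP[z /tN[_ zN] ->].
  have -> : y - a0 - (z - a0) = y - z by ring.
  exact: close.
- by move=> y _ ys /mapP[z zt ->]; apply: (inN _ (addN _ _ ys zt)).1.
- exact: large.
- by rewrite size_map; apply: large.
Qed.

(** Take [m] maximal with [2^(m+2) <= (4/3)^k]. Then [(4/3)^k < 8 * 2^m], and 224 is [8 * 28]. *)
Lemma cube_sqr_dim (N : int) (d : nat) (a0 : int) (a : 'I_d -> int) (k L : nat) :
  (k + k <= d)%N -> (0 < L)%N -> N < (2 ^ L)%N%:Z -> (forall i, 0 < a i) ->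
  hilbert_cube a0 a `<=` int_squares `&` `[1, N] ->
  (4 ^ k <= 224 * k.+1 * L * 3 ^ k)%N.
Proof.
move=> le_kd L_gt0 ltNL a_gt0 cubeN.
have pow3_gt0 : (0 < 3 ^ k)%N by rewrite expn_gt0.
(* Such an [m] exists once [(4/3)^k >= 4]; otherwise the bound is immediate. *)
have [le4|lt4] := leqP (4 * 3 ^ k) (4 ^ k); last by nia.
set v := trunc_log 2 (4 ^ k %/ 3 ^ k).
have v_ge2 : (2 <= v)%N by apply: trunc_log_max => //; rewrite leq_divRL.
have q_gt0 : (0 < 4 ^ k %/ 3 ^ k)%N by rewrite divn_gt0 // (leq_trans _ le4) // leq_pmull.
have le_v : (2 ^ v * 3 ^ k <= 4 ^ k)%N by rewrite -leq_divRL // trunc_logP.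
have lt_v : (4 ^ k < 2 ^ v.+1 * 3 ^ k)%N by rewrite -ltn_divLR // trunc_log_ltn.
have [m v_eq] : exists m, v = m.+2 by exists (v - 2)%N; lia.
rewrite v_eq in le_v lt_v.
have le_m := cube_sqr_sieve le_kd L_gt0 ltNL a_gt0 cubeN le_v.
(* Because [2^m * 3^k <= 4^k <= 6^k]. *)
have le_mk : (m <= k)%N.
  rewrite -(@leq_exp2l 2) // -(leq_pmul2r pow3_gt0).
  apply: leq_trans (_ : _ <= 2 ^ m.+2 * 3 ^ k)%N _; first by rewrite leq_pmul2r // leq_exp2l // -addn2 leq_addr.
  by rewrite (leq_trans le_v) // -expnMn; case: (k) => // j; rewrite leq_exp2r.
apply: leq_trans (ltnW lt_v) _; rewrite leq_pmul2r //.
apply: leq_trans (_ : 8 * (28 * m.+1 * L) <= _)%N; first by rewrite !expnS; lia.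
by rewrite !mulnA leq_mul // leq_mul.
Qed.

(** * Numerical estimates and the final bound *)

Lemma ln2_ge (R : realType) : 1 / 2 <= ln 2 :> R.
Proof.
rewrite -ler_expR lnK ?posrE //.
have := expR_ge1Dx (- (1 / 2) : R); rewrite expRN => le_inv.
have e_gt0 : 0 < expR (1 / 2) :> R by apply: expR_gt0.
by rewrite -(@ler_pV2 R) ?inE ?unitfE ?e_gt0 ?lt0r_neq0 //; lra.
Qed.

(* This is the inequality [2 / ln (4/3) < 7]; note [2/7 = 32/112]. *)
Lemma ln43_gt (R : realType) : 2 / 7 < ln (4 / 3) :> R.
Proof.
rewrite -ltr_expR lnK ?posrE; last by lra.
have e_gt0 : 0 < expR (2 / 7) :> R by apply: expR_gt0.
suff lt_inv : 3 / 4 < (expR (2 / 7))^-1 :> R.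
  by rewrite -(@ltf_pV2 R) ?posrE // invf_div.
(* The bound [e^y >= 1 + y] at [y = -2/7] gives only [5/7 < 3/4]; at [-1/112], followed by the 32nd
   power, it suffices. *)
rewrite -expRN; have -> : - (2 / 7) = 32%:R * (- (1 / 112)) :> R by field.
rewrite expRM_natl; apply: (@lt_le_trans _ _ ((111 / 112) ^+ 32)).
  have frac_pow (a b n : nat) : (0 < b)%N -> (3 * b ^ n < 4 * a ^ n)%N ->
      3 / 4 < (a%:R / b%:R) ^+ n :> R.
    move=> b_gt0; rewrite -(ltr_nat R) !natrM !natrX expr_div_n => lt_pow.
    rewrite ltr_pdivlMr ?exprn_gt0 ?ltr0n // mulrAC ltr_pdivrMr //.
    by rewrite [ltRHS]mulrC.
  have lt_pow : (3 * 112 ^ 32 < 4 * 111 ^ 32)%N by lia.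
  exact (frac_pow 111%N 112%N 32%N isT lt_pow).
apply: lerXn2r; rewrite ?nnegrE ?expR_ge0 //.
by apply: le_trans (expR_ge1Dx _); lra.
Qed.

(** With [x] as [log log N], the right side is about [e^((1+c)x)] where [1 + c = (7/2) ln(4/3) > 1],
    and the left side is [O(x e^x)]. *)
Lemma pow43_dominates (R : realType) : exists2 X0 : R, 1 < X0 &
  forall (x : R) (k L : nat), X0 <= x -> k%:R <= 7 / 2 * x < k.+1%:R ->
    L%:R <= 3 * expR x -> 224 * k.+1%:R * L%:R < (4 / 3) ^+ k :> R.
Proof.
have [c c_gt0 c_eq] : exists2 c : R, 0 < c & 7 / 2 * ln (4 / 3) = 1 + c.
  exists (7 / 2 * ln (4 / 3) - 1); last by rewrite addrC subrK.
  by have := ln43_gt R; lra.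
have c2_gt0 : 0 < c ^+ 2 by rewrite exprn_gt0.
have K_gt0 : 0 < 8960 / c ^+ 2.
  by apply: divr_gt0; [rewrite ltr0n | exact: c2_gt0].
(* If the claim failed, [k + 1 <= 5x] and [L <= 3 e^x] would give [e^(cx) <= 4480 x], where
   [4480 = (4/3) * 224 * 15]. This contradicts [e^(cx) >= 1 + (cx)^2 / 2] once [c^2 x > 8960]. *)
exists (1 + 8960 / c ^+ 2); first by rewrite ltrDl.
move=> x k L le_X0x /andP[le_k lt_k] le_L.
have x_gt1 : 1 < x by apply: lt_le_trans le_X0x; rewrite ltrDl.
have lt_Kx : 8960 < c ^+ 2 * x.
  by rewrite mulrC -(ltr_pdivrMr _ _ c2_gt0); apply: lt_le_trans le_X0x; rewrite ltrDr.
clear le_X0x K_gt0.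
have x_gt0 : 0 < x by apply: lt_trans x_gt1.
rewrite ltNge; apply/negP => le_pow.
have ge_pow : expR ((1 + c) * x) <= 4 / 3 * (4 / 3) ^+ k.
  rewrite -exprS.
  have -> : (4 / 3) ^+ k.+1 = expR (k.+1%:R * ln (4 / 3)) :> R.
    by rewrite expRM_natl lnK // posrE.
  rewrite ler_expR -c_eq mulrAC ler_wpM2r // ?ltW //.
  by apply: lt_trans (ln43_gt R).
have le_k1 : k.+1%:R <= 5 * x.
  by rewrite -[k.+1%:R]natr1; clear -le_k x_gt1; lra.
have expx_gt0 : 0 < expR x by apply: expR_gt0.
have le_cx : expR (c * x) <= 4480 * x.
  rewrite -(ler_pM2r expx_gt0) -expRD.
  have -> : c * x + x = (1 + c) * x by ring.
  have le_kL : k.+1%:R * L%:R <= 5 * x * (3 * expR x) by apply: ler_pM.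
  rewrite -mulrA in le_pow.
  by clear -le_kL ge_pow le_pow; lra.
have cx_ge0 : 0 <= c * x by rewrite mulr_ge0 // ltW.
have ge_cx : 1 + (c * x) ^+ 2 / 2 <= expR (c * x) := expR_ge1Dxn 1 cx_ge0.
have : 8960 * x < (c * x) ^+ 2.
  by rewrite exprMn [x ^+ 2]expr2 mulrA ltr_pM2r.
by clear -ge_cx le_cx; lra.
Qed.

Theorem theorem1 (R : realType) :
  exists N0 : int, forall N : int, N0 <= N ->
  forall (d : nat) (a0 : int) (a : 'I_d -> int),
    0 <= a0 ->
    (forall i, 0 < a i) ->
    injective a ->
    hilbert_cube a0 a `<=` int_squares `&` `[1, N] ->
    d%:R <= 7 * ln (ln N%:~R) :> R.
Proof.
have [X0 X0_gt1 dominates] := pow43_dominates R.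
exists (Num.ceil (expR (expR X0))) => N le_N0N d a0 a _ a_gt0 _ cubeN.
have le_expN : expR (expR X0) <= N%:~R :> R.
  by apply: le_trans (ceil_ge _) _; rewrite ler_int.
have N_gt0 : 0 < N%:~R :> R by apply: lt_le_trans le_expN; apply: expR_gt0.
have le_lnN : expR X0 <= ln N%:~R :> R by rewrite -ler_expR lnK ?posrE.
have lnN_gt0 : 0 < ln N%:~R :> R by apply: lt_le_trans le_lnN; apply: expR_gt0.
set x : R := ln (ln N%:~R).
have expx : expR x = ln N%:~R by rewrite lnK ?posrE.
have le_X0x : X0 <= x by rewrite -ler_expR expx.
rewrite leNgt; apply/negP => lt_d.
(* Since [d > 7x >= 2k], two blocks of [k] generators fit. *)
set k := Num.truncn (7 / 2 * x).
have k_itv : k%:R <= 7 / 2 * x < k.+1%:R by apply: truncn_itv; lra.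
have le_kd : (k + k <= d)%N by rewrite -(ler_nat R) natrD; case/andP: k_itv; lra.
have N_pos : 0 < N by rewrite -(ltr0z R).
(* The binary length of [N]; as [ln 2 >= 1/2], it is at most [2 ln N + 1 <= 3 e^x]. *)
set L := (trunc_log 2 `|N|).+1.
have ltNL : N < (2 ^ L)%N%:Z.
  by rewrite -[N in N < _]gez0_abs ?ltW // ltz_nat trunc_log_ltn.
have le_L : L%:R <= 3 * expR x.
  have : (2 ^ trunc_log 2 `|N| <= `|N|)%N by rewrite trunc_logP // absz_gt0 lt0r_neq0.
  rewrite -(ler_nat R) natrX natr_absz gtr0_norm // => le2N.
  have : ln (2 ^+ trunc_log 2 `|N|) <= ln N%:~R :> R by rewrite ler_ln ?posrE ?exprn_gt0.
  rewrite lnXn // -expx -[ln 2 *+ _]mulr_natl => le_log.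
  have := ler_wpM2l (ler0n R (trunc_log 2 `|N|)) (ln2_ge R).
  have -> : L%:R = (trunc_log 2 `|N|)%:R + 1 :> R by rewrite natr1.
  by have := expR_ge1Dx x; lra.
have := dominates x k L le_X0x k_itv le_L; rewrite ltNge => /negP; apply.
have := @cube_sqr_dim N d a0 a k L le_kd isT ltNL a_gt0 cubeN.
rewrite -(ler_nat R) !natrM !natrX => le_dim.
by rewrite expr_div_n ler_pdivrMr ?exprn_gt0.
Qed.
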